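(* Let $W$ be a finite reflection group in $\mathbb{R}^n$ with reflection set $T$, $\mathcal{N}$ its Nichols algebra, and $\mathcal{OS}$ its Orlik–Solomon algebra over $k$ with generators $\omega_t$ ($t\in T$). There is a well-defined surjective algebra morphism $\mathcal{N}\to\mathcal{OS}$ with $t\mapsto\omega_t$ for $t\in T$. In particular $\mathcal{OS}$ is a quotient of $\mathcal{N}$.
   Context: $t^u=u^{-1}tu$. Twisted shuffle $\star$ on $\mathcal{T}(k^T)$: $(t_1\otimes\cdots\otimes t_i)\star(u_1\otimes\cdots\otimes u_j)=t_1\otimes((t_2\otimes\cdots\otimes t_i)\star(u_1\otimes\cdots\otimes u_j))+(-1)^iu_1\otimes((t_1^{u_1}\otimes\cdots\otimes t_i^{u_1})\star(u_2\otimes\cdots\otimes u_j))$; the signed shuffle $\diamond$ is defined by the same recursion without the conjugations ($t_k^{u_1}$ replaced by $t_k$). $\mathcal{N}$ is the $\star$-subalgebra of $\mathcal{T}(k^T)$ generated by $T$; $E$ is the $\diamond$-subalgebra generated by $T$ (the exterior algebra $\bigwedge(k^T)$ realized as antisymmetric tensors, with wedge product $\diamond$). For $t\in T$ let $H_t=\ker(t-I)\subset\mathbb{R}^n$, and let $L$ be the set of all intersections of such hyperplanes. Define the linear map $\lambda:\mathcal{T}(k^T)\to\mathcal{T}(k^{L\setminus\{0\}})$ by $\lambda(t_1\otimes\cdots\otimes t_j)=H_{t_1}\otimes(H_{t_1}\cap H_{t_2})\otimes\cdots\otimes(\bigcap_{i=1}^jH_{t_i})$ if $\bigcap_{i=1}^jH_{t_i}\ne\{0\}$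 and $0$ otherwise. The Orlik–Solomon algebra is $\mathcal{OS}=E/I$ with $I=E\cap\lambda^{-1}(0)$ (an ideal of $(E,\diamond)$), with product denoted $\wedge$, and $\omega_t$ is the class of $t$. *)

(* Defs.v *)
From HB Require Import structures.
From mathcomp Require Import all_boot all_order all_algebra.
From mathcomp Require Import boolp classical_sets functions cardinality reals.
From mathcomp Require Import finmap monalg.

Set Implicit Arguments.
Unset Strict Implicit.
Unset Printing Implicit Defensive.

Import GRing.Theory Num.Theory.
Local Open Scope ring_scope.
Local Open Scope classical_set_scope.

HB.lock Definition linext (k : nzRingType) (K : choiceType) (V : lmodType k)
  (h : K -> V) (g : {malg k[K]}) : V := \sum_(a <- msupp g) g@_a *: h a.

Section LinearExtension.
Variables (k : nzRingType) (K : choiceType) (V : lmodType k).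
Implicit Types (h : K -> V) (g : {malg k[K]}).

Lemma linextE h g : linext h g = \sum_(a <- msupp g) g@_a *: h a.
Proof. by rewrite unlock. Qed.

Lemma linextEw h g (d : {fset K}) : (msupp g `<=` d)%fset ->
  linext h g = \sum_(a <- d) g@_a *: h a.
Proof.
move=> sgd; rewrite linextE; apply/big_fset_incl => // a _ aNg.
by rewrite mcoeff_outdom // scale0r.
Qed.

Fact linext_is_linear h : linear (linext h).
Proof.
move=> c g1 g2; pose d := (msupp g1 `|` msupp g2 `|` msupp (c *: g1 + g2))%fset.
rewrite !(@linextEw _ _ d) ?fsubsetUr // /d -?fsetUA ?fsubsetUl //; last first.
  by rewrite fsetUCA fsubsetUl.
rewrite scaler_sumr -big_split /=; apply: eq_bigr => a _.
by rewrite mcoeffD mcoeffZ scalerDl scalerA.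
Qed.

HB.instance Definition _ h :=
  GRing.isLinear.Build k {malg k[K]} V _ (linext h) (linext_is_linear h).

Lemma linextU h a : linext h << a >> = h a.
Proof.
rewrite (@linextEw _ _ [fset a]%fset) ?msuppU_le // big_seq_fset1.
by rewrite mcoeffUU scale1r.
Qed.

Lemma linear_malg_eq (f1 f2 : {linear {malg k[K]} -> V}) :
  (forall a, f1 << a >> = f2 << a >>) -> forall g, f1 g = f2 g.
Proof.
move=> ef g; have -> : g = \sum_(a <- msupp g) g@_a *: << a >>.
  rewrite {1}[g]monalgE; apply: eq_bigr => a _.
  by apply/malgP => b; rewrite mcoeffZ !mcoeffU mulr_natr.
by rewrite !linear_sum; apply: eq_bigr => a _; rewrite !linearZ /= ef.
Qed.

End LinearExtension.

(* A choiceType with an operation a ^ u that is self-distributive, which is   *)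
(* what makes the twisted shuffle below associative. The two instances used   *)
(* are conjugation on the reflections of a group and the trivial operation.   *)
Record rack := Rack {
  rack_sort :> choiceType;
  rack_op : rack_sort -> rack_sort -> rack_sort;
  rack_opA : forall a u v : rack_sort,
    rack_op (rack_op a u) v = rack_op (rack_op a v) (rack_op u v) }.

Definition triv_rack (A : choiceType) : rack :=
  @Rack A (fun a _ => a) (fun _ _ _ => erefl).

Section ShuffleProduct.
Variables (k : comNzRingType) (Q : rack).

Local Notation tens := {malg k[seq Q]}.

Definition lcons (a : Q) : tens -> tens := linext (fun w => << a :: w >>).
HB.instance Definition _ a := GRing.Linear.on (lcons a).

(* See shuffle_wordE for the defining recursion.                              *)
Fixpoint shuffle_word (s w : seq Q) {struct w} : tens :=
  if w is u :: w' then
    (fix aux s := if s is a :: s' then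
        lcons a (aux s') + (-1) ^+ size s *:
          lcons u (shuffle_word [seq rack_op x u | x <- s] w')
      else << w >>) s
  else << s >>.

Lemma shuffle_wordE a s u w : shuffle_word (a :: s) (u :: w) =
  lcons a (shuffle_word s (u :: w)) + (-1) ^+ (size s).+1 *:
    lcons u (shuffle_word [seq rack_op x u | x <- a :: s] w).
Proof. by []. Qed.

Lemma shuffle_word0s w : shuffle_word [::] w = << w >>.
Proof. by case: w. Qed.

Lemma shuffle_words0 s : shuffle_word s [::] = << s >>.
Proof. by []. Qed.

Definition shuffle (x y : tens) : tens :=
  linext (fun s => linext (fun w => shuffle_word s w) y) x.

Lemma shuffleUU s w : shuffle << s >> << w >> = shuffle_word s w.
Proof. by rewrite /shuffle !linextU. Qed.

Lemma shuffle_linearl y : linear (shuffle^~ y).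
Proof. by move=> c x1 x2; rewrite /shuffle linearP. Qed.

Lemma shuffle_linearr x : linear (shuffle x).
Proof.
move=> c y1 y2; rewrite /shuffle !(linextE _ x) scaler_sumr -big_split /=.
apply: eq_bigr => s _; rewrite linearP.
by rewrite scalerDr !scalerA [c * _]mulrC.
Qed.

HB.instance Definition _ x := GRing.isLinear.Build k tens tens _ (shuffle x)
  (shuffle_linearr x).

Definition shl y : tens -> tens := shuffle^~ y.
HB.instance Definition _ y := GRing.isLinear.Build k tens tens _ (shl y)
  (shuffle_linearl y).

Lemma shuffle1l : left_id << [::] >> shuffle.
Proof.
move=> y; rewrite -[RHS]/(@idfun tens y).
by apply: linear_malg_eq => w; rewrite /= shuffleUU shuffle_word0s.
Qed.

Lemma shuffle1r : right_id << [::] >> shuffle.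
Proof.
move=> x; rewrite -[LHS]/(shl << [::] >> x) -[RHS]/(@idfun tens x).
by apply: linear_malg_eq => w; rewrite /= /shl shuffleUU shuffle_words0.
Qed.

Lemma shuffleDl : left_distributive shuffle +%R.
Proof. by move=> x y z; rewrite -/(shl z (x + y)) linearD. Qed.

Lemma shuffleDr : right_distributive shuffle +%R.
Proof. by move=> x y z; rewrite linearD. Qed.

Lemma shuffleNl x y : shuffle (- x) y = - shuffle x y.
Proof. by rewrite -[LHS]/(shl y (- x)) linearN. Qed.

Lemma shuffleNr x y : shuffle x (- y) = - shuffle x y.
Proof. by rewrite linearN. Qed.

Lemma shuffleZl c x y : c *: shuffle x y = shuffle (c *: x) y.
Proof. by rewrite -[RHS]/(shl y (c *: x)) linearZ. Qed.

Lemma shuffleZr c x y : c *: shuffle x y = shuffle x (c *: y).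
Proof. by rewrite linearZ. Qed.

Definition tw (u : Q) : tens -> tens :=
  linext (fun w => (-1) ^+ size w *: << [seq rack_op x u | x <- w] >>).
HB.instance Definition _ u := GRing.Linear.on (tw u).

Lemma twD u x y : tw u (x + y) = tw u x + tw u y.
Proof. exact: linearD. Qed.

Lemma twN u x : tw u (- x) = - tw u x.
Proof. exact: linearN. Qed.

Lemma lconsD a x y : lcons a (x + y) = lcons a x + lcons a y.
Proof. exact: linearD. Qed.

Lemma lconsN a x : lcons a (- x) = - lcons a x.
Proof. exact: linearN. Qed.

Lemma lconsZ c a x : lcons a (c *: x) = c *: lcons a x.
Proof. exact: linearZ. Qed.

Lemma twU u w : tw u << w >> =
  (-1) ^+ size w *: << [seq rack_op x u | x <- w] >>.
Proof. exact: linextU. Qed.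

Lemma lconsU a w : lcons a << w >> = << a :: w >>.
Proof. exact: linextU. Qed.

Lemma tw_lcons u a x : tw u (lcons a x) = - lcons (rack_op a u) (tw u x).
Proof.
rewrite -[LHS]/((tw u \o lcons a) x).
rewrite -[RHS]/((-%R \o (lcons (rack_op a u) \o tw u)) x).
apply: linear_malg_eq => w /=.
by rewrite lconsU !twU linearZ /= lconsU exprS mulN1r scaleNr.
Qed.

Lemma shuffle_lcons a x u y : shuffle (lcons a x) (lcons u y) =
  lcons a (shuffle x (lcons u y)) + lcons u (shuffle (tw u (lcons a x)) y).
Proof.
pose f1 := shuffle (lcons a x) \o lcons u.
pose f2 := (lcons a \o (shuffle x \o lcons u)) \+
           (lcons u \o shuffle (tw u (lcons a x))).
rewrite -[LHS]/(f1 y) -[RHS]/(f2 y); apply: linear_malg_eq => w {y}.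
rewrite {}/f1 {}/f2 /=.
pose g1 := shl (lcons u << w >>) \o lcons a.
pose g2 := (lcons a \o shl (lcons u << w >>)) \+
           (lcons u \o (shl << w >> \o (tw u \o lcons a))).
rewrite -[LHS]/(g1 x) -[RHS]/(g2 x); apply: linear_malg_eq => s {x}.
rewrite {}/g1 {}/g2 /= /shl !lconsU !shuffleUU shuffle_wordE twU.
by rewrite -shuffleZl linearZ /= shuffleUU.
Qed.

Lemma tw_comm v u x : tw v (tw u x) = tw (rack_op u v) (tw v x).
Proof.
rewrite -[LHS]/((tw v \o tw u) x) -[RHS]/((tw (rack_op u v) \o tw v) x).
apply: linear_malg_eq => w /=.
rewrite !twU !linearZ /= !twU !size_map -!map_comp; congr (_ *: (_ *: << _ >>)).
by apply: eq_map => a /=; rewrite rack_opA.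
Qed.

Lemma tw_shuffle v x y : tw v (shuffle x y) = shuffle (tw v x) (tw v y).
Proof.
pose f1 := tw v \o shuffle x; pose f2 := shuffle (tw v x) \o tw v.
rewrite -[LHS]/(f1 y) -[RHS]/(f2 y); apply: linear_malg_eq => w {y}.
rewrite {}/f1 {}/f2 /=.
elim: w x => [|u w IHw] x.
  by rewrite shuffle1r twU scale1r /= shuffle1r.
pose g1 := tw v \o shl << u :: w >>.
pose g2 := shl (tw v << u :: w >>) \o tw v.
rewrite -[LHS]/(g1 x) -[RHS]/(g2 x); apply: linear_malg_eq => s {x}.
rewrite {}/g1 {}/g2 /= /shl.
elim: s => [|a s IHs]; first by rewrite shuffle1l [in RHS]twU scale1r shuffle1l.
move: IHs; rewrite -!lconsU; move: << s >> << w >> IHw => X Y IHw IHs.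
rewrite shuffle_lcons twD (tw_lcons v a (shuffle _ _)).
rewrite (tw_lcons v u (shuffle _ _)) IHs IHw tw_comm !(tw_lcons v).
rewrite shuffleNl !shuffleNr opprK shuffle_lcons.
by rewrite twN shuffleNl !lconsN !opprK.
Qed.

Lemma shuffleA : associative shuffle.
Proof.
move=> x y z; apply: esym.
pose f1 := shuffle (shuffle x y); pose f2 := shuffle x \o shuffle y.
rewrite -[LHS]/(f1 z) -[RHS]/(f2 z); apply: linear_malg_eq => w {z}.
rewrite {}/f1 {}/f2 /=.
elim: w x y => [|v w IHw] x y; first by rewrite !shuffle1r.
pose g1 := shl << v :: w >> \o shuffle x.
pose g2 := shuffle x \o shl << v :: w >>.
rewrite -[LHS]/(g1 y) -[RHS]/(g2 y); apply: linear_malg_eq => b {y}.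
rewrite {}/g1 {}/g2 /= /shl.
elim: b x => [|u b IHb] x; first by rewrite shuffle1l shuffle1r.
pose h1 := shl << v :: w >> \o shl << u :: b >>.
pose h2 := shl (shuffle << u :: b >> << v :: w >>).
rewrite -[LHS]/(h1 x) -[RHS]/(h2 x); apply: linear_malg_eq => a {x}.
rewrite {}/h1 {}/h2 /= /shl.
elim: a => [|t a IHa]; first by rewrite !shuffle1l.
move: IHa IHb; rewrite -!lconsU.
move: << a >> << b >> << w >> IHw => A B C IHw IHa IHb.
transitivity (lcons t (shuffle A (shuffle (lcons u B) (lcons v C)))
   + lcons u (shuffle (tw u (lcons t A)) (shuffle B (lcons v C)))
   + lcons v (shuffle (tw v (lcons t A)) (shuffle (tw v (lcons u B)) C))).
  rewrite -IHa -IHb -IHw -tw_shuffle.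
  rewrite [in RHS](shuffle_lcons t A u B).
  rewrite [in LHS](shuffle_lcons t A u B) shuffleDl !shuffle_lcons.
  by rewrite twD shuffleDl lconsD addrACA.
rewrite (shuffle_lcons u B v C) !shuffleDr.
by rewrite (shuffle_lcons t A u) (shuffle_lcons t A v) !lconsD [RHS]addrACA addrA.
Qed.

Lemma shuffle_oner_neq0 : << [::] >> != 0 :> tens.
Proof. by rewrite monalgU_eq0 oner_eq0. Qed.

End ShuffleProduct.

(* The tensor algebra on k^Q, as a module, with the shuffle product.          *)
Definition shuffle_alg (k : comNzRingType) (Q : rack) : Type := {malg k[seq Q]}.

Section ShuffleAlgebra.
Variables (k : comNzRingType) (Q : rack).
Local Notation S := (shuffle_alg k Q).

HB.instance Definition _ := GRing.Lmodule.copy S {malg k[seq Q]}.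
HB.instance Definition _ := GRing.Zmodule_isNzRing.Build S
  (@shuffleA k Q) (@shuffle1l k Q) (@shuffle1r k Q)
  (@shuffleDl k Q) (@shuffleDr k Q) (@shuffle_oner_neq0 k Q).
HB.instance Definition _ := GRing.Lmodule_isLalgebra.Build k S (@shuffleZl k Q).
HB.instance Definition _ := GRing.Lalgebra_isAlgebra.Build k S (@shuffleZr k Q).

Definition letter (a : Q) : S := << [:: a] >>.

End ShuffleAlgebra.

Section GeneratedSubalgebra.
Variables (k : comNzRingType) (A : algType k) (X : set A).

Definition subalg_gen : {pred A} := [pred x : A | `[< forall S : {pred A},
  subalg_closed S -> (forall y, X y -> y \in S) -> x \in S >]].

Lemma subalg_gen_closed : subalg_closed subalg_gen.
Proof.
split=> [|c x y /asboolP Sx /asboolP Sy|x y /asboolP Sx /asboolP Sy];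
  apply/asboolP => S algS XS; have [S1 Slin SM] := algS => //.
- by apply: Slin; [exact: Sx | exact: Sy].
- by apply: SM; [exact: Sx | exact: Sy].
Qed.

Lemma mem_subalg_gen x : X x -> x \in subalg_gen.
Proof. by move=> Xx; apply/asboolP => S _; exact. Qed.

HB.instance Definition _ := GRing.isSubalgClosed.Build k A subalg_gen
  (GRing.subalg_closed_semi subalg_gen_closed).

Definition gen_subalg : Type := {x : A | x \in subalg_gen}.

HB.instance Definition _ := SubType.on gen_subalg.
HB.instance Definition _ := Choice.on gen_subalg.
HB.instance Definition _ := [SubChoice_isSubAlgebra of gen_subalg by <:].

End GeneratedSubalgebra.

(* Proper, as nzRingType requires 1 != 0 in the quotient.                     *)
Record twosided_ideal (k : comNzRingType) (A : algType k) := TwosidedIdeal {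
  pideal :> {pred A};
  pidealB : zmod_closed pideal;
  pidealMl : forall x y, y \in pideal -> x * y \in pideal;
  pidealMr : forall x y, x \in pideal -> x * y \in pideal;
  pideal1 : 1 \notin pideal }.

Section QuotientAlgebra.
Variables (k : comNzRingType) (A : algType k) (I : twosided_ideal A).

Definition ideal_eq (x y : A) := x - y \in I.

Let I0 : 0 \in I. Proof. by have [] := pidealB I. Qed.
Let IB : {in I &, forall x y, x - y \in I}. Proof. by have [] := pidealB I. Qed.
Let IN : {in I, forall x, - x \in I}.
Proof. by move=> x Ix; rewrite -sub0r IB. Qed.
Let ID : {in I &, forall x y, x + y \in I}.
Proof. by move=> x y Ix Iy; rewrite -[y]opprK IB ?IN. Qed.

Lemma ideal_eq_equiv : equiv_class_of ideal_eq.
Proof.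
split=> [x|x y|y x z]; rewrite /ideal_eq ?subrr //.
  by apply/idP/idP => /IN; rewrite opprB.
by move=> Ixy Iyz; rewrite -(subrKA y) ID.
Qed.

Canonical ideal_eq_equivRel := EquivRelPack ideal_eq_equiv.

Definition quot_alg : Type := {eq_quot ideal_eq}%qT.

HB.instance Definition _ := Choice.on quot_alg.
HB.instance Definition _ := EqQuotient.on quot_alg.

Definition quot_pi (x : A) : quot_alg := (\pi_quot_alg x)%qT.

Lemma quot_piE x y : quot_pi x = quot_pi y <-> x - y \in I.
Proof. by split=> [/eqquotP|H]; last exact/eqquotP. Qed.

Let rep (a : quot_alg) : A := repr a.

Let repK a : quot_pi (rep a) = a. Proof. exact: reprK. Qed.

Let repP x : rep (quot_pi x) - x \in I.
Proof. by apply/quot_piE; rewrite repK. Qed.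

Definition quot_add a b := quot_pi (rep a + rep b).
Definition quot_opp a := quot_pi (- rep a).
Definition quot_mul a b := quot_pi (rep a * rep b).
Definition quot_scale (c : k) a := quot_pi (c *: rep a).

Let piD x y : quot_pi (x + y) = quot_add (quot_pi x) (quot_pi y).
Proof. by apply/esym/quot_piE; rewrite opprD addrACA ID ?repP. Qed.

Let piN x : quot_pi (- x) = quot_opp (quot_pi x).
Proof. by apply/esym/quot_piE; rewrite -opprD IN ?repP. Qed.

Let piM x y : quot_pi (x * y) = quot_mul (quot_pi x) (quot_pi y).
Proof.
apply/esym/quot_piE; set x' := rep _; set y' := rep _.
have -> : x' * y' - x * y = (x' - x) * y' + x * (y' - y).
  by rewrite mulrBl mulrBr subrKA.
by apply: ID; [exact/pidealMr/repP | exact/pidealMl/repP].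
Qed.

Let piZ c x : quot_pi (c *: x) = quot_scale c (quot_pi x).
Proof.
by apply/esym/quot_piE; rewrite -scalerBr -mulr_algl pidealMl ?repP.
Qed.

Fact quot_addA : associative quot_add.
Proof. by move=> a b c; rewrite -(repK a) -(repK b) -(repK c) -!piD addrA. Qed.
Fact quot_addC : commutative quot_add.
Proof. by move=> a b; rewrite -(repK a) -(repK b) -!piD addrC. Qed.
Fact quot_add0 : left_id (quot_pi 0) quot_add.
Proof. by move=> a; rewrite -(repK a) -!piD add0r. Qed.
Fact quot_addN : left_inverse (quot_pi 0) quot_opp quot_add.
Proof. by move=> a; rewrite -(repK a) -piN -!piD addNr. Qed.

HB.instance Definition _ := GRing.isZmodule.Build quot_alg
  quot_addA quot_addC quot_add0 quot_addN.

Fact quot_mulA : associative quot_mul.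
Proof. by move=> a b c; rewrite -(repK a) -(repK b) -(repK c) -!piM mulrA. Qed.
Fact quot_mul1 : left_id (quot_pi 1) quot_mul.
Proof. by move=> a; rewrite -(repK a) -!piM mul1r. Qed.
Fact quot_mulr1 : right_id (quot_pi 1) quot_mul.
Proof. by move=> a; rewrite -(repK a) -!piM mulr1. Qed.
Fact quot_mulDl : left_distributive quot_mul +%R.
Proof.
by move=> a b c; rewrite -(repK a) -(repK b) -(repK c) -![_ + _]piD -!piM -[RHS]piD mulrDl.
Qed.
Fact quot_mulDr : right_distributive quot_mul +%R.
Proof.
by move=> a b c; rewrite -(repK a) -(repK b) -(repK c) -![_ + _]piD -!piM -[RHS]piD mulrDr.
Qed.
Fact quot_oner_neq0 : quot_pi 1 != 0.
Proof. by apply/eqP => /quot_piE; rewrite subr0; apply/negP/pideal1. Qed.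

HB.instance Definition _ := GRing.Zmodule_isNzRing.Build quot_alg
  quot_mulA quot_mul1 quot_mulr1 quot_mulDl quot_mulDr quot_oner_neq0.

Fact quot_scaleA a b x : quot_scale a (quot_scale b x) = quot_scale (a * b) x.
Proof. by rewrite -(repK x) -!piZ scalerA. Qed.
Fact quot_scale1 : left_id 1 quot_scale.
Proof. by move=> a; rewrite -(repK a) -piZ scale1r. Qed.
Fact quot_scaleDr : right_distributive quot_scale +%R.
Proof.
by move=> c a b; rewrite -(repK a) -(repK b) -[_ + _]piD -!piZ -[RHS]piD scalerDr.
Qed.
Fact quot_scaleDl x : {morph quot_scale^~ x : a b / a + b}.
Proof. by move=> a b; rewrite -(repK x) -!piZ -[RHS]piD scalerDl. Qed.

HB.instance Definition _ := GRing.Zmodule_isLmodule.Build k quot_alg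
  quot_scaleA quot_scale1 quot_scaleDr quot_scaleDl.

Fact quot_scaleAl (c : k) (x y : quot_alg) : c *: (x * y) = (c *: x) * y.
Proof.
rewrite -(repK x) -(repK y).
by rewrite -[_ * _]piM -[LHS]piZ -[c *: quot_pi _]piZ -[RHS]piM scalerAl.
Qed.
HB.instance Definition _ := GRing.Lmodule_isLalgebra.Build k quot_alg
  quot_scaleAl.

Fact quot_scaleAr (c : k) (x y : quot_alg) : c *: (x * y) = x * (c *: y).
Proof.
rewrite -(repK x) -(repK y).
by rewrite -[_ * _]piM -[LHS]piZ -[c *: quot_pi _]piZ -[RHS]piM scalerAr.
Qed.
HB.instance Definition _ := GRing.Lalgebra_isAlgebra.Build k quot_alg
  quot_scaleAr.

Fact quot_pi_linear : linear quot_pi.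
Proof. by move=> c x y; rewrite piD piZ. Qed.
HB.instance Definition _ := GRing.isLinear.Build k A quot_alg _ quot_pi
  quot_pi_linear.

Fact quot_pi_monoid_morphism : monoid_morphism quot_pi.
Proof. by split=> [|x y]; rewrite ?piM. Qed.
HB.instance Definition _ := GRing.isMonoidMorphism.Build A quot_alg quot_pi
  quot_pi_monoid_morphism.

End QuotientAlgebra.

Section ReflectionGroups.
Variables (R : realType) (n : nat).

Definition reflection (v : 'cV[R]_n) : 'M[R]_n :=
  1%:M - (2 / (v^T *m v) 0 0) *: (v *m v^T).

Definition is_reflection : set 'M[R]_n :=
  [set A | exists2 v, v != 0 & A = reflection v].

Definition matrix_group (G : set 'M[R]_n) : Prop :=
  [/\ G `<=` [set A | A \in unitmx], G 1%:M,
      forall A B, G A -> G B -> G (A *m B) & forall A, G A -> G (invmx A)].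

(* A finite subgroup of O(n) generated by the reflections it contains.        *)
Record refl_group := ReflGroup {
  refl_group_set :> set 'M[R]_n;
  refl_group_finite : finite_set refl_group_set;
  refl_group_group : matrix_group refl_group_set;
  refl_group_gen : forall G, matrix_group G ->
    refl_group_set `&` is_reflection `<=` G -> refl_group_set `<=` G }.

Lemma dot_gt0 (v : 'cV[R]_n) : v != 0 -> 0 < (v^T *m v) 0 0.
Proof.
move=> v0; have ge0 i : true -> 0 <= v^T 0 i * v i 0.
  by rewrite mxE -expr2 sqr_ge0.
rewrite lt0r mxE sumr_ge0 // andbT; apply: contra v0 => /eqP/(psumr_eq0P ge0) H.
apply/eqP/colP => i; apply/eqP; rewrite mxE -sqrf_eq0 expr2.
by have := H i isT; rewrite mxE => ->.
Qed.

Lemma reflectionK v : v != 0 -> reflection v *m reflection v = 1%:M.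
Proof.
move=> /dot_gt0/lt0r_neq0; rewrite /reflection.
set d := (v^T *m v) 0 0 => d0; set c := 2 / d.
rewrite mulmxBl mul1mx mulmxBr mulmx1 -scalemxAl -scalemxAr mulmxA.
rewrite -(mulmxA v) [v^T *m v]mx11_scalar -/d mul_mx_scalar -scalemxAl !scalerA.
by rewrite mulfVK // mulr_natr mulr2n scalerDl opprB addrK subrK.
Qed.

Lemma tr_reflection v : (reflection v)^T = reflection v.
Proof.
by rewrite /reflection linearB linearZ /= trmx_mul trmxK tr_scalar_mx.
Qed.
Lemma invmx_reflection u : is_reflection u ->
  [/\ u \in unitmx, invmx u = u & u^T = u].
Proof.
case=> v v0 ->; have K := reflectionK v0; have U := mulmx1_unit K.
split; [by case: U | | exact: tr_reflection].
by rewrite -[LHS]mulmx1 -K mulKmx //; case: U.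
Qed.

Lemma is_reflection_conj t u : is_reflection t -> is_reflection u ->
  is_reflection (invmx u *m t *m u).
Proof.
move=> [v v0 ->] /invmx_reflection[uU uV uT].
exists (u *m v).
  by apply: contra v0 => /eqP uv; rewrite -(mulKmx uU v) uv mulmx0.
have uu : u *m u = 1%:M by rewrite -{1}uV mulVmx.
rewrite uV /reflection trmx_mul uT mulmxBr mulmxBl mulmx1 uu.
rewrite -scalemxAr -scalemxAl !mulmxA.
by rewrite -(mulmxA v^T u u) uu mulmx1.
Qed.

Definition refl (W : refl_group) : choiceType := set_type (W `&` is_reflection).

Variable W : refl_group.

Lemma refl_conj_subproof (t u : refl W) :
  invmx (val u) *m val t *m val u \in W `&` is_reflection.
Proof.
have [Wt rt] := set_mem (valP t); have [Wu ru] := set_mem (valP u).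
have [_ _ WM WV] := refl_group_group W.
by apply/mem_set; split; [apply: (WM _ _ (WM _ _ (WV _ Wu) Wt) Wu) |
  exact: is_reflection_conj].
Qed.

Definition refl_conj (t u : refl W) : refl W :=
  exist _ (invmx (val u) *m val t *m val u) (refl_conj_subproof t u).

Lemma refl_conjA t u v :
  refl_conj (refl_conj t u) v = refl_conj (refl_conj t v) (refl_conj u v).
Proof.
apply: val_inj => /=.
have [_ /invmx_reflection[uU uV _]] := set_mem (valP u).
have [_ /invmx_reflection[vU vV _]] := set_mem (valP v).
have vv : val v *m val v = 1%:M by rewrite -{1}vV mulVmx.
have [_ /invmx_reflection[_ -> _]] := set_mem (refl_conj_subproof u v).
rewrite uV vV !mulmxA -(mulmxA (_ *m val u) (val v)) vv mulmx1.
by rewrite -(mulmxA (_ *m val t) (val v)) vv mulmx1.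
Qed.

Definition conj_rack : rack := Rack refl_conjA.

Definition hyperplane (t : refl W) : {vspace 'cV[R]_n} :=
  lker (linfun (mulmx (val t - 1%:M))).

Definition flats : set {vspace 'cV[R]_n} :=
  [set U | exists s : seq (refl W), U = (\bigcap_(t <- s) hyperplane t)%VS].

Definition flat : choiceType := set_type (flats `\ 0%VS).

(* The flag (H_t1, H_t1 :&: H_t2, ...) of a word t1 t2 ...                    *)
Definition flag (w : seq (refl W)) : seq {vspace 'cV[R]_n} :=
  scanl (fun U t => (U :&: hyperplane t)%VS) fullv w.

End ReflectionGroups.

Section OrlikSolomon.
Variables (R : realType) (n : nat) (k : comNzRingType) (W : refl_group R n).

Local Notation T := (refl W).
Local Notation H := (@hyperplane R n W).
Local Notation space := {vspace 'cV[R]_n}.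
Local Notation tens := {malg k[seq T]}.
Local Notation ftens := {malg k[seq space]}.
Local Notation capH := (fun (U : space) (t : T) => (U :&: H t)%VS).

(* For w = [::] (degree 0) the value is the empty tensor 1, so that lambda is *)
(* the identity on k even when n = 0. If the intersection is not {0} then no  *)
(* entry of the flag is lost by pmap: see val_lambda_word.                    *)
Definition lambda_word (w : seq T) : {malg k[seq (flat W)]} :=
  if (w != [::]) && (\bigcap_(t <- w) H t == 0)%VS then 0
  else << pmap (insub : space -> option (flat W)) (flag w) >>.

Definition lambda : tens -> {malg k[seq (flat W)]} := linext lambda_word.
HB.instance Definition _ := GRing.Linear.on lambda.

Lemma mem0_scanl U w : (0%VS \in scanl capH U w) =
  (w != [::]) && ((U :&: \bigcap_(t <- w) H t)%VS == 0%VS).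
Proof.
elim: w U => [|t w IHw] U //=; rewrite in_cons IHw big_cons capvA eq_sym.
case: eqP => [->|/eqP UN0] /=; first by rewrite cap0v eqxx.
by case: w {IHw} => [|u w] //=; rewrite big_nil capvf (negPf UN0).
Qed.

Lemma flats_scanl U w : flats W U -> {in scanl capH U w, forall V, flats W V}.
Proof.
elim: w U => [|t w IHw] U [s ->] V //=.
have fU : flats W (\bigcap_(t <- s) H t :&: H t)%VS.
  by exists (rcons s t); rewrite -cats1 big_cat big_seq1.
by rewrite inE => /predU1P[->|/IHw] //; exact.
Qed.

Lemma val_lambda_word w :
    ~~ ((w != [::]) && (\bigcap_(t <- w) H t == 0)%VS) ->
  map val (pmap (insub : space -> option (flat W)) (flag w)) = flag w.
Proof.
move=> wN0; rewrite (pmap_filter (@insubK _ _ _)).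
apply/all_filterP/allP => U Uw; rewrite isSome_insub; apply/mem_set; split.
  by apply: flats_scanl Uw; exists [::]; rewrite big_nil.
move=> U0; move/negP: wN0; apply.
by rewrite -[(\bigcap_(_ <- _) _)%VS]capfv -mem0_scanl -U0.
Qed.

Definition phi U : tens -> ftens := linext (fun w : seq T => << scanl capH U w >>).
HB.instance Definition _ U := GRing.Linear.on (phi U).

Definition kap : ftens -> ftens :=
  linext (fun F : seq space => if 0%VS \in F then 0 else << F >>).
HB.instance Definition _ := GRing.Linear.on kap.

Lemma lambda_eq0 x : lambda x = 0 <-> kap (phi fullv x) = 0.
Proof.
pose iota : {malg k[seq (flat W)]} -> ftens :=
  linext (fun F : seq (flat W) => << map val F >>).
pose rho : ftens -> {malg k[seq (flat W)]} := linext
  (fun F : seq space => << pmap (insub : space -> option (flat W)) F >>).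
have kill w : (0%VS \in scanl capH fullv w) =
    (w != [::]) && (\bigcap_(t <- w) H t == 0)%VS.
  by rewrite mem0_scanl capfv.
have lk y : iota (lambda y) = kap (phi fullv y).
  rewrite -[LHS]/((iota \o lambda) y) -[RHS]/((kap \o phi fullv) y).
  apply: linear_malg_eq => w /=.
  rewrite /lambda /phi /kap !linextU kill /lambda_word.
  case: ifPn => [_|wN0]; first by rewrite linear0.
  by rewrite /iota linextU val_lambda_word.
have kl y : rho (kap (phi fullv y)) = lambda y.
  rewrite -[LHS]/((rho \o (kap \o phi fullv)) y).
  apply: linear_malg_eq => w /=.
  rewrite /lambda /phi /kap !linextU kill /lambda_word.
  by case: ifPn => [_|wN0]; rewrite ?linear0 // /rho linextU.
by split=> x0; [rewrite -lk x0 /iota linear0 | rewrite -kl x0 /rho linear0].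
Qed.

Definition vcons (X : space) : ftens -> ftens :=
  linext (fun F : seq space => << X :: F >>).
HB.instance Definition _ X := GRing.Linear.on (vcons X).

Lemma phiD U x y : phi U (x + y) = phi U x + phi U y.
Proof. exact: linearD. Qed.

Lemma phiZ U c x : phi U (c *: x) = c *: phi U x.
Proof. exact: linearZ. Qed.

Lemma phi_lcons U t x :
  phi U (@lcons k (triv_rack T) t x) =
  vcons (U :&: H t)%VS (phi (U :&: H t)%VS x).
Proof.
rewrite -[LHS]/((phi U \o @lcons k (triv_rack T) t) x).
rewrite -[RHS]/((vcons (U :&: H t)%VS \o phi (U :&: H t)%VS) x).
apply: linear_malg_eq => w /=.
by rewrite /phi /vcons /lcons !linextU.
Qed.

Fixpoint mix (b : seq T) (U : space) (F : seq space) {struct b} : ftens :=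
  if b is t :: b' then
    (fix aux U F := if F is X :: F' then
        vcons (U :&: X)%VS (aux (U :&: X)%VS F') + (-1) ^+ size F *:
          vcons (U :&: H t)%VS (mix b' (U :&: H t)%VS F)
      else << scanl capH U b >>) U F
  else << scanl (fun U X => (U :&: X)%VS) U F >>.

Lemma mix_cons t b U X F : mix (t :: b) U (X :: F) =
  vcons (U :&: X)%VS (mix (t :: b) (U :&: X)%VS F) + (-1) ^+ (size F).+1 *:
    vcons (U :&: H t)%VS (mix b (U :&: H t)%VS (X :: F)).
Proof. by []. Qed.

Lemma mixE b (U V : space) a : (U <= V)%VS ->
  mix b U (scanl capH V a) =
  phi U (@shuffle_word k (triv_rack T) a b).
Proof.
elim: b U V a => [|u b IHb] U V a leUV.
  rewrite shuffle_words0 /phi linextU /=; congr << _ >>.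
  elim: a U V leUV => //= t a IHa U V leUV.
  by rewrite capvA (capv_idPl leUV) IHa // capvS.
elim: a U V leUV => [|t a IHa] U V leUV.
  by rewrite shuffle_word0s /phi linextU.
rewrite shuffle_wordE phiD phiZ !phi_lcons.
have -> : scanl capH V (t :: a) =
    (V :&: H t)%VS :: scanl capH (V :&: H t)%VS a by [].
rewrite mix_cons capvA (capv_idPl leUV) size_scanl.
apply: congr2; first by apply: congr1; apply: IHa; apply: capvS.
apply: congr1; apply: congr1; rewrite (map_id (t :: a)).
by apply: (IHb _ V (t :: a)); apply: subv_trans leUV; apply: capvSl.
Qed.

Lemma kap_vcons0 x : kap (vcons 0%VS x) = 0.
Proof.
rewrite -[LHS]/((kap \o vcons 0%VS) x) -[RHS]/((\0 : ftens -> ftens) x).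
by apply: linear_malg_eq => F /=; rewrite /kap /vcons !linextU mem_head.
Qed.

Lemma kap_vcons X x : kap x = 0 -> kap (vcons X x) = 0.
Proof.
have [->|XN0] := eqVneq X 0%VS; first by rewrite kap_vcons0.
suff -> : kap (vcons X x) = vcons X (kap x) by move=> ->; rewrite linear0.
rewrite -[LHS]/((kap \o vcons X) x) -[RHS]/((vcons X \o kap) x).
apply: linear_malg_eq => F /=; rewrite /kap /vcons !linextU in_cons eq_sym.
by rewrite (negPf XN0) /=; case: ifP => _; rewrite ?linear0 // linextU.
Qed.

Lemma kap_mix b U F : 0%VS \in F -> kap (mix b U F) = 0.
Proof.
elim: b U F => [|u b IHb] U F F0.
  rewrite /kap linextU; case: ifPn => // /negP[].
  elim: F U F0 => //= X F IHF U; rewrite !inE => /predU1P[<-|/IHF->].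
    by rewrite capv0 eqxx.
  by rewrite orbT.
elim: F U F0 => //= X F IHF U XF0.
rewrite [LHS]linearD linearZ /= [X in _ *: X]kap_vcons ?IHb // scaler0 addr0.
move: XF0; rewrite in_cons => /predU1P[<-|F0]; first by rewrite capv0 kap_vcons0.
by rewrite kap_vcons ?IHF.
Qed.

Local Notation dshuffle := (@shuffle k (triv_rack T)).

Lemma lambda_dshufflel x y : lambda x = 0 -> lambda (dshuffle x y) = 0.
Proof.
move=> /lambda_eq0 x0; apply/lambda_eq0.
rewrite -[LHS]/((kap \o (phi fullv \o dshuffle x)) y).
rewrite -[RHS]/((\0 : tens -> ftens) y).
apply: linear_malg_eq => b /= {y}.
pose Psi : ftens -> ftens := linext (fun F : seq space => kap (mix b fullv F)).
have -> : kap (phi fullv (dshuffle x << b >>)) = Psi (phi fullv x).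
  rewrite -[LHS]/((kap \o (phi fullv \o @shl k (triv_rack T) << b >>)) x).
  rewrite -[RHS]/((Psi \o phi fullv) x).
  apply: linear_malg_eq => a /=.
  by rewrite /shl shuffleUU /Psi {2}/phi !linextU (@mixE _ _ fullv).
have -> : Psi (phi fullv x) = Psi (kap (phi fullv x)).
  move: (phi _ _) => y; rewrite -[RHS]/((Psi \o kap) y).
  apply: linear_malg_eq => F /=; rewrite /Psi [in RHS]/kap !linextU.
  by case: ifPn => F0; rewrite ?linextU // linear0 kap_mix.
by rewrite x0 /Psi linear0.
Qed.

Definition gsign (A : choiceType) (m : nat) : {malg k[seq A]} -> {malg k[seq A]} :=
  linext (fun w : seq A => (-1) ^+ (size w * m) *: << w >>).
HB.instance Definition _ A m := GRing.Linear.on (@gsign A m).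

Lemma dshuffle_wordC (a b : seq T) :
  @shuffle_word k (triv_rack T) b a =
  (-1) ^+ (size a * size b) *: @shuffle_word k (triv_rack T) a b.
Proof.
elim: b a => [|u b IHb] a; first by rewrite muln0 scale1r shuffle_word0s.
elim: a => [|t a IHa]; first by rewrite scale1r shuffle_word0s.
have mapE v (s : seq T) : [seq @rack_op (triv_rack T) x v | x <- s] = s.
  exact: map_id.
rewrite !shuffle_wordE !mapE IHa (IHb (t :: a)).
rewrite !lconsZ scalerDr !scalerA addrC.
apply: congr2; apply: (congr1 (fun c : k => c *: _)).
  by rewrite mulSn exprD.
by rewrite -exprD -mulnSr -signr_odd -[RHS]signr_odd !oddD !oddM /=;
   case: odd; case: odd.
Qed.

Lemma lambda_dshuffler x y : lambda x = 0 -> lambda (dshuffle y x) = 0.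
Proof.
move=> x0.
rewrite -[LHS]/((lambda \o @shl k (triv_rack T) x) y).
rewrite -[RHS]/((\0 : tens -> {malg k[seq (flat W)]}) y).
apply: linear_malg_eq => b /= {y}.
have -> : @shl k (triv_rack T) x << b >> = dshuffle (gsign (size b) x) << b >>.
  rewrite -[LHS]/(dshuffle << b >> x).
  rewrite -[RHS]/((@shl k (triv_rack T) << b >> \o @gsign T (size b)) x).
  apply: linear_malg_eq => a /=.
  by rewrite /gsign linextU linearZ /= /shl !shuffleUU dshuffle_wordC.
apply/lambda_dshufflel/lambda_eq0.
have -> : kap (phi fullv (gsign (size b) x)) =
          gsign (size b) (kap (phi fullv x)).
  rewrite -[LHS]/((kap \o (phi fullv \o @gsign T (size b))) x).
  rewrite -[RHS]/((@gsign {vspace 'cV[R]_n} (size b) \o (kap \o phi fullv)) x).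
  apply: linear_malg_eq => a /=.
  rewrite /gsign linextU !linearZ /= /phi /kap !linextU.
  by case: ifP => _; rewrite ?linear0 ?scaler0 // linextU size_scanl.
by move/lambda_eq0: x0 => ->; rewrite linear0.
Qed.

(* The twisted shuffle is shuffle on conj_rack W, where                       *)
(* rack_op t u = t ^ u = u^-1 t u; the signed shuffle is shuffle on           *)
(* triv_rack T.                                                               *)
Definition nichols : Type := gen_subalg (range (@letter k (conj_rack W))).
HB.instance Definition _ := GRing.Algebra.on nichols.

Definition nichols_gen (t : T) : nichols :=
  exist _ (letter k (t : conj_rack W)) (mem_subalg_gen (imageT _ t)).

Definition ext_alg : Type := gen_subalg (range (@letter k (triv_rack T))).
HB.instance Definition _ := GRing.Algebra.on ext_alg.

Definition ext_gen (t : T) : ext_alg :=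
  exist _ (letter k (t : triv_rack T)) (mem_subalg_gen (imageT _ t)).

Definition os_ideal_pred : {pred ext_alg} := [pred x | lambda (val x) == 0].

Lemma os_ideal_zmod_closed : zmod_closed os_ideal_pred.
Proof.
split=> [|x y]; rewrite !inE /=; first by apply/eqP; exact: linear0.
move=> /eqP x0 /eqP y0; apply/eqP.
by rewrite raddfB /= x0 y0 subr0.
Qed.

Lemma os_idealMl x y : y \in os_ideal_pred -> x * y \in os_ideal_pred.
Proof. by rewrite !inE => /eqP y0; apply/eqP/lambda_dshuffler. Qed.

Lemma os_idealMr x y : x \in os_ideal_pred -> x * y \in os_ideal_pred.
Proof. by rewrite !inE => /eqP x0; apply/eqP/lambda_dshufflel. Qed.

Lemma os_ideal1 : 1 \notin os_ideal_pred.
Proof. by rewrite inE /= /lambda linextU monalgU_eq0 oner_eq0. Qed.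

Definition os_ideal : twosided_ideal ext_alg :=
  TwosidedIdeal os_ideal_zmod_closed os_idealMl os_idealMr os_ideal1.

Definition orlik_solomon : Type := quot_alg os_ideal.
HB.instance Definition _ := GRing.Algebra.on orlik_solomon.

Definition omega (t : T) : orlik_solomon := quot_pi os_ideal (ext_gen t).

End OrlikSolomon.

(* Main.v *)
Require Import Defs.
From HB Require Import structures.
From mathcomp Require Import all_boot all_order all_algebra.
From mathcomp Require Import boolp classical_sets functions cardinality reals.
From mathcomp Require Import finmap monalg.

(** A reflection [u] fixes [H_u] pointwise, so [H_u :&: H_(t^u) = H_u :&: H_t].
    In the twisted shuffle a letter is conjugated by [u] only after [u] has been
    placed to its left, so the conjugations do not change the associated flags:
    [lambda (x * y)] is the same for the twisted and for the signed product.
    Since the kernel of [lambda] is an ideal for the signed product, sending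
    [x] in the Nichols algebra to the class of any antisymmetric tensor [e] with
    [lambda e = lambda x] is a well-defined morphism, and by the same argument
    every antisymmetric tensor arises in this way. *)

Set Implicit Arguments.
Unset Strict Implicit.
Unset Printing Implicit Defensive.

Import GRing.Theory.
Local Open Scope ring_scope.

Lemma linear_linext (k : nzRingType) (K : choiceType) (V V' : lmodType k)
    (f : {linear V -> V'}) (h : K -> V) (g : {malg k[K]}) :
  f (linext h g) = linext (fun a => f (h a)) g.
Proof.
by rewrite !linextE linear_sum; apply: eq_bigr => a _; rewrite linearZ.
Qed.

Lemma eq_linext (k : nzRingType) (K : choiceType) (V : lmodType k)
    (h h' : K -> V) (g : {malg k[K]}) : h =1 h' -> linext h g = linext h' g.
Proof. by move=> /funext->. Qed.

Section NicholsToOrlikSolomon.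
Variables (R : realType) (n : nat) (k : comNzRingType) (W : refl_group R n).

Local Notation T := (refl W).
Local Notation H := (@hyperplane R n W).
Local Notation space := {vspace 'cV[R]_n}.
Local Notation tens := {malg k[seq T]}.
Local Notation lambda := (@lambda R n k W).
Local Notation phi := (@phi R n k W).
Local Notation vcons := (@vcons R n k).
Local Notation star := (@shuffle k (conj_rack W)).
Local Notation diamond := (@shuffle k (triv_rack T)).

Lemma mem_hyperplane (t : T) x : (x \in H t) = (val t *m x == x).
Proof. by rewrite memv_ker lfunE /= mulmxBl mul1mx subr_eq0. Qed.

Lemma capv_hyperplane_conj (t u : T) :
  (H u :&: H (refl_conj t u) = H u :&: H t)%VS.
Proof.
apply/vspaceP => x; rewrite !memv_cap !mem_hyperplane /=.
case: eqP => //= ux; have [_ /invmx_reflection[uU _ _]] := set_mem (valP u).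
rewrite -!mulmxA ux; apply/eqP/eqP => [tx|->]; last by rewrite -{1}ux mulKmx.
(* Applying [u] to [u^-1 t x = x] gives [t x = u x], which is [x] on [H u]. *)
by rewrite -[LHS](mulKVmx uU) tx.
Qed.

(** A trace on [V] is the trace on [U] cut by [V]. This transports equality of traces as the
    recursion shrinks the ambient subspace. *)
Lemma map_capv_sub (U V : space) (a b : seq T) : (V <= U)%VS ->
  [seq (U :&: H t)%VS | t <- a] = [seq (U :&: H t)%VS | t <- b] ->
  [seq (V :&: H t)%VS | t <- a] = [seq (V :&: H t)%VS | t <- b].
Proof.
move=> leVU /(congr1 (map (fun X => (V :&: X)%VS))).
rewrite -!map_comp.
by congr (_ = _); apply: eq_map => t /=; rewrite capvA (capv_idPl leVU).
Qed.

(** Prefixing a letter involves no conjugation, so the trivial rack case applies by conversion. *)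
Lemma phi_lcons_conj U (t : T) x :
  phi U (@lcons k (conj_rack W) t x) =
  vcons (U :&: H t)%VS (phi (U :&: H t)%VS x).
Proof. exact: phi_lcons. Qed.

Lemma phi_star_cons U (t u : T) (a b : seq T) :
  phi U (@shuffle_word k (conj_rack W) (t :: a) (u :: b)) =
  vcons (U :&: H t)%VS
    (phi (U :&: H t)%VS (@shuffle_word k (conj_rack W) a (u :: b))) +
  (-1) ^+ (size a).+1 *: vcons (U :&: H u)%VS
    (phi (U :&: H u)%VS
       (@shuffle_word k (conj_rack W) [seq refl_conj s u | s <- t :: a] b)).
Proof.
apply: (etrans (congr1 (phi U) (@shuffle_wordE k (conj_rack W) t a u b))).
by rewrite phiD phiZ !phi_lcons_conj.
Qed.

Lemma phi_diamond_cons U (t u : T) (a b : seq T) :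
  phi U (@shuffle_word k (triv_rack T) (t :: a) (u :: b)) =
  vcons (U :&: H t)%VS
    (phi (U :&: H t)%VS (@shuffle_word k (triv_rack T) a (u :: b))) +
  (-1) ^+ (size a).+1 *: vcons (U :&: H u)%VS
    (phi (U :&: H u)%VS (@shuffle_word k (triv_rack T) (t :: a) b)).
Proof.
apply: (etrans (congr1 (phi U) (@shuffle_wordE k (triv_rack T) t a u b))).
by rewrite phiD phiZ !phi_lcons (map_id (t :: a)).
Qed.

(* Allowing two words with the same traces on [U] absorbs the conjugations.   *)
Lemma phi_shuffle_word (b : seq T) U (a a' : seq T) :
  [seq (U :&: H t)%VS | t <- a] = [seq (U :&: H t)%VS | t <- a'] ->
  phi U (@shuffle_word k (conj_rack W) a b) =
  phi U (@shuffle_word k (triv_rack T) a' b).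
Proof.
elim: b U a a' => [|u b IHb] U a a'.
  rewrite !shuffle_words0 /phi !linextU => eqa; congr << _ >>.
  elim: a U a' eqa => [|t a IHa] U [|t' a'] //= eqa.
  have /= eqt := congr1 (head 0%VS) eqa; have /= {}eqa := congr1 behead eqa.
  by rewrite eqt (IHa _ a') //; apply: map_capv_sub eqa; apply: capvSl.
elim: a U a' => [|t a IHa] U [|t' a'] eqa.
- by rewrite !shuffle_word0s.
- by have := congr1 size eqa.
- by have := congr1 size eqa.
have /= eqt := congr1 (head 0%VS) eqa; have /= eqa' := congr1 behead eqa.
have eqs : size a = size a' by have := congr1 size eqa'; rewrite !size_map.
apply: etrans (esym (phi_diamond_cons U t' u a' b)).
apply: (etrans (phi_star_cons U t u a b)); rewrite eqt eqs.
apply: congr2; apply: congr1.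
  by apply: IHa; apply: map_capv_sub eqa'; apply: capvSl.
apply: congr1; apply: IHb.
(* The letter [u] has just been placed, so all traces are now taken inside [H u], where conjugation
   by [u] is invisible. *)
rewrite -(map_capv_sub (capvSl U (H u)) eqa) -map_comp.
by apply: eq_map => s /=; rewrite -!capvA capv_hyperplane_conj.
Qed.

(** [phi fullv] records every flag, including those reaching 0 that [lambda] discards. *)
Lemma lambda_phi (x y : tens) : phi fullv x = phi fullv y -> lambda x = lambda y.
Proof.
move=> exy; apply/eqP; rewrite -subr_eq0 -linearB; apply/eqP/lambda_eq0.
by rewrite [phi _ _]linearB /= exy subrr linear0.
Qed.

Lemma phi_star U (x y : tens) : phi U (star x y) =
  linext (fun a : seq T => linext (fun b : seq T =>
    phi U (@shuffle_word k (conj_rack W) a b)) y) x.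
Proof.
apply: (etrans (linear_linext (phi U) _ _)); apply: eq_linext => a.
exact: linear_linext.
Qed.

Lemma phi_diamond U (x y : tens) : phi U (diamond x y) =
  linext (fun a : seq T => linext (fun b : seq T =>
    phi U (@shuffle_word k (triv_rack T) a b)) y) x.
Proof.
apply: (etrans (linear_linext (phi U) _ _)); apply: eq_linext => a.
exact: linear_linext.
Qed.

Lemma lambda_star (x y : tens) : lambda (star x y) = lambda (diamond x y).
Proof.
apply: lambda_phi.
apply: etrans (esym (phi_diamond fullv x y)).
apply: (etrans (phi_star fullv x y)).
apply: eq_linext => a; apply: eq_linext => b.
(* Here the two words coincide, so the hypothesis on traces is trivial. *)
exact: phi_shuffle_word.
Qed.

Lemma lambda_diamond (x x' y y' : tens) : lambda x = lambda x' -> lambda y = lambda y' ->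
  lambda (diamond x y) = lambda (diamond x' y').
Proof.
move=> /eqP; rewrite -subr_eq0 -linearB => /eqP ex.
move=> /eqP; rewrite -subr_eq0 -linearB => /eqP ey.
(* With the signed product, [x y - x' y' = (x - x') y + x' (y - y')], and the kernel of [lambda] is
   a two-sided ideal. *)
have := lambda_dshufflel y ex; have := lambda_dshuffler x' ey.
rewrite linearB /= linearB /= => /eqP; rewrite subr_eq0 => /eqP <-.
by rewrite shuffleDl shuffleNl linearB /= => /eqP; rewrite subr_eq0 => /eqP.
Qed.

Lemma lambda_nichols_ext (x : nichols k W) :
  exists e : ext_alg k W, lambda (val e) = lambda (val x).
Proof.
(* [S] contains the letters and is closed under the twisted product, hence contains the subalgebra
   they generate. *)
pose S : {pred shuffle_alg k (conj_rack W)} :=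
  [pred y | `[< exists e : ext_alg k W, lambda (val e) = lambda y >]].
suff /asboolP : val x \in S by [].
move: (valP x) => /asboolP; apply.
  split=> [|c y z /asboolP[e ey] /asboolP[f fz]|y z /asboolP[e ey] /asboolP[f fz]];
    apply/asboolP.
  - by exists 1.
  - by exists (c *: e + f); rewrite !linearP /= ey fz.
  - by exists (e * f); rewrite [RHS]lambda_star; apply: lambda_diamond.
by move=> _ [t _ <-]; apply/asboolP; exists (ext_gen k t).
Qed.

Lemma lambda_ext_nichols (e : ext_alg k W) :
  exists x : nichols k W, lambda (val x) = lambda (val e).
Proof.
pose S : {pred shuffle_alg k (triv_rack T)} :=
  [pred y | `[< exists x : nichols k W, lambda (val x) = lambda y >]].
suff /asboolP : val e \in S by [].
move: (valP e) => /asboolP; apply.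
  split=> [|c y z /asboolP[e1 ey] /asboolP[f fz]|y z /asboolP[e1 ey] /asboolP[f fz]];
    apply/asboolP.
  - by exists 1.
  - by exists (c *: e1 + f); rewrite !linearP /= ey fz.
  - by exists (e1 * f); rewrite [LHS]lambda_star; apply: lambda_diamond.
by move=> _ [t _ <-]; apply/asboolP; exists (nichols_gen k t).
Qed.

Definition nichols_os (x : nichols k W) : orlik_solomon k W :=
  quot_pi (os_ideal k W) (sval (cid (lambda_nichols_ext x))).

(** Two choices of [e] differ by an element of the ideal. Each property of the map thus reduces to
    exhibiting one suitable representative. *)
Lemma nichols_osE (x : nichols k W) (e : ext_alg k W) : lambda (val e) = lambda (val x) ->
  nichols_os x = quot_pi (os_ideal k W) e.
Proof.
move=> ex; apply/quot_piE; case: cid => e' /= e'x.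
by rewrite inE /= linearB /= e'x ex subrr.
Qed.

Fact nichols_os_is_linear : linear nichols_os.
Proof.
move=> c x y; have [e ex] := lambda_nichols_ext x.
have [f fy] := lambda_nichols_ext y.
rewrite (nichols_osE ex) (nichols_osE fy) -linearP; apply: nichols_osE.
by rewrite !linearP /= ex fy.
Qed.
HB.instance Definition _ := GRing.isLinear.Build k (nichols k W)
  (orlik_solomon k W) _ nichols_os nichols_os_is_linear.

Fact nichols_os_is_monoid_morphism : monoid_morphism nichols_os.
Proof.
split=> [|x y].
  have e1 : lambda (val (1 : ext_alg k W)) = lambda (val (1 : nichols k W)).
    (* Both units are the empty word. *)
    exact: (erefl (lambda << [::] >>)).
  exact: (etrans (nichols_osE e1) (rmorph1 _)).
have [e ex] := lambda_nichols_ext x; have [f fy] := lambda_nichols_ext y.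
rewrite (nichols_osE ex) (nichols_osE fy) -rmorphM; apply: nichols_osE.
by rewrite [RHS]lambda_star; apply: lambda_diamond.
Qed.
HB.instance Definition _ := GRing.isMonoidMorphism.Build (nichols k W)
  (orlik_solomon k W) nichols_os nichols_os_is_monoid_morphism.

(** The letter [t] lies in both algebras and represents itself. *)
Lemma nichols_os_gen t : nichols_os (nichols_gen k t) = omega k t.
Proof. exact: nichols_osE. Qed.

Lemma nichols_os_surj y : exists x, nichols_os x = y.
Proof.
have [x xy] := lambda_ext_nichols (repr y); exists x.
by rewrite (nichols_osE (esym xy)); apply: reprK.
Qed.

End NicholsToOrlikSolomon.

Theorem theorem7p15 (R : realType) (n : nat) (k : comNzRingType)
    (W : refl_group R n) :
  exists f : {lrmorphism nichols k W -> orlik_solomon k W},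
    (forall t : refl W, f (nichols_gen k t) = omega k t) /\
    (forall y : orlik_solomon k W, exists x : nichols k W, f x = y).
Proof.
exists (@nichols_os R n k W).
by split; [exact: nichols_os_gen | exact: nichols_os_surj].
Qed.
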